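(* Let $X$ be a metric space and $Y$ a subset of $X$. The following statements are equivalent: (1) $Y$ is a closed subset of $X$; (2) $Y$ is an $L$-retract of $X$; (3) $Y$ is $\ell$-embedded in $X$.
   Context: All topological spaces are Tychonoff; all locally convex spaces are real and Hausdorff. $C(X)$ is the set of continuous real functions on $X$ and $C_p(X)$ is $C(X)$ with the topology of pointwise convergence. $Y\subset X$ is $\ell$-embedded in $X$ if there is a continuous linear mapping $\phi: C_p(Y)\to C_p(X)$ with $\phi(f)|Y=f$ for all $f\in C(Y)$. The free locally convex space $L(X)$ over $X$ is a locally convex space with a continuous injection $\delta_X: X\to L(X)$ such that $L(X)$ is the linear span of $\delta_X(X)$ and every continuous $f: X\to E$ to a locally convex space $E$ satisfies $f=f_\#\circ\delta_X$ for a (unique) continuous linear $f_\#: L(X)\to E$. It exists and is unique up to topological isomorphism, $\delta_X$ is a closed topological embedding, and $\delta_X(X)$ is a Hamel basis; $X$ is identified with $\delta_X(X)$. For $Y\subset X$, $L(Y)$ (with its own free topology) is identified as a vector space with the linear span of $Y$ in $L(X)$; $Y$ is $L$-embedded in $X$ if the topology of $L(Y)$ is the subspace topology from $L(X)$. $Y$ is an $L$-retract of $X$ if $Y$ is $L$-embedded in $X$ and there is a continuous linear retraction $r: L(X)\to L(Y)$ (that is, $r$ is the identity on $L(Y)$). *)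

(* Defs.v *)
From HB Require Import structures.
From mathcomp Require Import all_boot all_order all_algebra finmap lra.
From mathcomp Require Import all_classical all_reals all_analysis.

Set Implicit Arguments.
Unset Strict Implicit.
Unset Printing Implicit Defensive.

Import Order.TTheory GRing.Theory Num.Theory.
Import numFieldNormedType.Exports.

Local Open Scope classical_set_scope.
Local Open Scope ring_scope.

Section Cp.
Context (R : realType) (X : topologicalType).

Definition continuous_fun : {pred X -> R} := mem [set f : X -> R | continuous f].

Record Cp := MkCp { Cp_fun :> X -> R ; _ : Cp_fun \in continuous_fun }.

HB.instance Definition _ := [isSub for Cp_fun].
HB.instance Definition _ := [Choice of Cp by <:].

Fact continuous_fun_submod_closed : submod_closed continuous_fun.
Proof.
split; first by rewrite inE /= => x; exact: cvg_cst.
move=> a f g; rewrite !inE /= => cf cg x; apply: cvgD; last exact: cg.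
by apply: cvgM; [exact: cvg_cst|exact: cf].
Qed.

HB.instance Definition _ :=
  GRing.isSubmodClosed.Build R (X -> R) continuous_fun
    continuous_fun_submod_closed.
HB.instance Definition _ := [SubChoice_isSubLmodule of Cp by <:].
HB.instance Definition _ :=
  Topological.copy Cp (initial_topology (Cp_fun : Cp -> {ptws X -> R})).

End Cp.

Definition ell_embedded (R : realType) (X : topologicalType) (Y : set X) : Prop :=
  exists phi : {linear Cp R Y -> Cp R X},
    continuous phi /\ forall (f : Cp R Y) (y : Y), phi f (set_val y) = f y.

(* A [tvsType] is locally convex by definition, but need not be Hausdorff.
   In [free_lcs_lift], uniqueness of [g] follows from [free_lcs_span]. *)
Record free_lcs_axiom (R : realType) (X : topologicalType) (L : tvsType R)
    (delta : X -> L) : Prop := {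
  free_lcs_hausdorff : hausdorff_space L ;
  free_lcs_continuous : continuous delta ;
  free_lcs_inj : injective delta ;
  free_lcs_span : forall u : L, exists (n : nat) (a : 'I_n -> R) (x : 'I_n -> X),
    u = \sum_(i < n) a i *: delta (x i) ;
  free_lcs_lift : forall (E : tvsType R) (f : X -> E),
    hausdorff_space E -> continuous f ->
    exists2 g : {linear L -> E}, continuous g & forall x, g (delta x) = f x
}.

Record free_lcs (R : realType) (X : topologicalType) := FreeLcs {
  free_lcs_sort :> tvsType R ;
  free_lcs_delta : X -> free_lcs_sort ;
  free_lcsP : free_lcs_axiom free_lcs_delta
}.

Section Lembedded.
Context (R : realType) (X : topologicalType) (Y : set X).
Context (LX : free_lcs R X) (LY : free_lcs R Y).

(* [j] is the map through which L(Y) is identified with the span of Y in L(X);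
   it exists by the universal property of L(Y) and is unique because Y spans
   L(Y). *)
Definition span_inclusion (j : {linear LY -> LX}) : Prop :=
  forall y : Y, j (free_lcs_delta LY y) = free_lcs_delta LX (set_val y).

Definition L_embedded : Prop :=
  exists j : {linear LY -> LX}, [/\ span_inclusion j, injective j &
    forall U : set LY, open U <-> exists2 V : set LX, open V & j @^-1` V = U].

Definition L_retract : Prop :=
  L_embedded /\
  exists (j : {linear LY -> LX}) (r : {linear LX -> LY}),
    [/\ span_inclusion j, continuous r & cancel j r].

End Lembedded.

(* Existence of L(X): finitely supported functions X -> R, with the finest
   locally convex topology for which the embedding of X is continuous. *)
Module FreeLcs.
Section FreeLcs.
Context (R : realType) (X : topologicalType).

Definition fin_supp : {pred X -> R} :=
  mem [set f : X -> R | exists A : {fset X}, forall x, x \notin A -> f x = 0].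

Record L := MkL { coef :> X -> R ; _ : coef \in fin_supp }.

HB.instance Definition _ := [isSub for coef].
HB.instance Definition _ := [Choice of L by <:].

Fact fin_supp_submod_closed : submod_closed fin_supp.
Proof.
split; first by rewrite inE /=; exists fset0.
move=> a f g; rewrite !inE /= => -[A fA] [B gB]; exists (A `|` B)%fset => x.
rewrite in_fsetU negb_or => /andP[xA xB].
by rewrite -[LHS]/(a * f x + g x) fA// gB// addr0 mulr0.
Qed.

HB.instance Definition _ :=
  GRing.isSubmodClosed.Build R (X -> R) fin_supp fin_supp_submod_closed.
HB.instance Definition _ := [SubChoice_isSubLmodule of L by <:].

Lemma L_supp (u : L) : exists A : {fset X}, forall x, x \notin A -> u x = 0.
Proof. by case: u => f /=; rewrite inE. Qed.

Lemma L_eqP (u v : L) : (forall x, u x = v x) -> u = v.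
Proof. by move=> uv; apply: val_inj; apply/funext. Qed.

Fact delta_supp (x : X) : (fun y : X => (y == x)%:R : R) \in fin_supp.
Proof.
rewrite inE /=; exists [fset x]%fset => y.
by rewrite in_fset1 => /negbTE ->.
Qed.

Definition delta (x : X) : L := MkL (delta_supp x).

Section lift.
Context (E : lmodType R) (f : X -> E).

Definition lift (u : L) : E := \sum_(x \in [set: X]) u x *: f x.

Lemma liftE (u : L) (A : {fset X}) : (forall x, x \notin A -> u x = 0) ->
  lift u = \sum_(x <- A) u x *: f x.
Proof. by move=> uA; apply: fsbigTE => x /uA ->; rewrite scale0r. Qed.

Lemma lift_linear : linear lift.
Proof.
move=> a u v; have [A uA] := L_supp u; have [B vB] := L_supp v.
have uAB x : x \notin (A `|` B)%fset -> u x = 0.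
  by rewrite in_fsetU negb_or => /andP[/uA].
have vAB x : x \notin (A `|` B)%fset -> v x = 0.
  by rewrite in_fsetU negb_or => /andP[_ /vB].
rewrite (liftE uAB) (liftE vAB) (@liftE _ (A `|` B)%fset); last first.
  by by move=> x xAB; rewrite -[LHS]/(a * u x + v x) uAB// vAB// addr0 mulr0.
rewrite scaler_sumr -big_split /=; apply: eq_bigr => x _.
by rewrite scalerA -scalerDl.
Qed.

Lemma lift_delta x : lift (delta x) = f x.
Proof.
rewrite (@liftE _ [fset x]%fset); last first.
  by move=> y; rewrite in_fset1 /= => /negbTE ->.
by rewrite big_seq_fset1 [delta x x](_ : _ = (x == x)%:R)// eqxx scale1r.
Qed.

End lift.

HB.instance Definition _ (E : lmodType R) (f : X -> E) :=
  GRing.isLinear.Build R L E *:%R (lift f) (lift_linear f).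

Lemma lift_deltaK (u : L) : lift delta u = u.
Proof.
have [A uA] := L_supp u; rewrite (liftE _ uA); apply: L_eqP => y.
transitivity (\sum_(x <- A) u x * (y == x)%:R).
  by elim/big_rec2: _ => // x v r _ <-.
have [yA|yA] := boolP (y \in A).
  rewrite (bigD1_seq y) ?fset_uniq//= eqxx mulr1 big1 ?addr0// => x /negbTE.
  by rewrite eq_sym => ->; rewrite mulr0.
rewrite uA// big_seq big1// => x xA; have [yx|] := eqVneq y x.
  by rewrite -yx (negPf yA) in xA.
by rewrite mulr0.
Qed.

Record good (W : set L) : Prop := {
  good_convex : forall u v (t : R), W u -> W v -> 0 <= t -> t <= 1 ->
    W (t *: u + (1 - t) *: v) ;
  good_sym : forall u, W u -> W (- u) ;
  good_absorb : forall u, \forall t \near (0 : R), W (t *: u) ;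
  good_delta : forall (c : R) x0, \forall x \near x0, W (c *: (delta x - delta x0))
}.

Lemma good0 W : good W -> W 0.
Proof.
move=> gW; have := good_absorb gW 0 => /nbhs_singleton.
by rewrite scale0r.
Qed.

Lemma good_half W u v : good W -> W (2 *: u) -> W (2 *: v) -> W (u + v).
Proof.
move=> gW Wu Wv; have := @good_convex _ gW _ _ (2^-1) Wu Wv.
have -> : 1 - 2^-1 = 2^-1 :> R by lra.
by rewrite !scalerA mulVf// !scale1r; apply; lra.
Qed.

Lemma good_balanced W (c : R) u : good W -> `|c| <= 1 -> W u -> W (c *: u).
Proof.
move=> gW; rewrite ler_norml => /andP[c1 c2] Wu.
have := @good_convex _ gW _ _ ((1 + c) / 2) Wu (good_sym gW Wu).
rewrite scalerN -scalerBl.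
have -> : (1 + c) / 2 - (1 - (1 + c) / 2) = c by lra.
by apply; lra.
Qed.

Lemma goodT : good setT.
Proof. by split=> //= *; exact: filterT. Qed.

Lemma goodI W1 W2 : good W1 -> good W2 -> good (W1 `&` W2).
Proof.
move=> g1 g2; split.
- move=> u v t [u1 u2] [v1 v2] t0 t1.
  by split; [exact: (good_convex g1)|exact: (good_convex g2)].
- by move=> u [u1 u2]; split; [exact: (good_sym g1)|exact: (good_sym g2)].
- by move=> u; apply: filterI; [exact: (good_absorb g1)|exact: (good_absorb g2)].
- by move=> c x; apply: filterI; [exact: (good_delta g1)|exact: (good_delta g2)].
Qed.

Lemma goodZ W (c : R) : good W -> good [set u | W (c *: u)].
Proof.
move=> gW; split=> /=.
- move=> u v t Wu Wv t0 t1; rewrite scalerDr !scalerA ![c * _]mulrC -!scalerA.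
  exact: (good_convex gW).
- by move=> u Wu; rewrite scalerN; exact: (good_sym gW).
- move=> u; have := good_absorb gW (c *: u); apply: filterS => t.
  by rewrite !scalerA mulrC.
- by move=> d x0; have := good_delta gW (c * d) x0; apply: filterS => x;
    rewrite scalerA.
Qed.

Definition Lnbhs (u : L) : set_system L :=
  [set U | exists2 W, good W & forall w, W w -> U (u + w)].

HB.instance Definition _ := hasNbhs.Build L Lnbhs.

Fact Lnbhs_filter (u : L) : ProperFilter (Lnbhs u).
Proof.
split; first by move=> [W gW /(_ _ (good0 gW))].
split; first by exists setT => //; exact: goodT.
- move=> P Q [W1 g1 P1] [W2 g2 Q2]; exists (W1 `&` W2); first exact: goodI.
  by move=> w [/P1 ? /Q2].
- by move=> P Q PQ [W gW WP]; exists W => // w /WP /PQ.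
Qed.

Fact Lnbhs_singleton (u : L) (U : set L) : Lnbhs u U -> U u.
Proof. by move=> [W gW /(_ _ (good0 gW))]; rewrite addr0. Qed.

Fact Lnbhs_nbhs (u : L) (U : set L) : Lnbhs u U -> Lnbhs u (Lnbhs^~ U).
Proof.
move=> [W gW WU]; exists [set w | W (2 *: w)]; first exact: goodZ.
move=> w Ww; exists [set w | W (2 *: w)]; first exact: goodZ.
by move=> v Wv; rewrite -addrA; apply: WU; exact: good_half.
Qed.

HB.instance Definition _ := Nbhs_isNbhsTopological.Build L
  Lnbhs_filter Lnbhs_singleton Lnbhs_nbhs.

Fact Ladd_continuous : continuous (fun x : L * L => x.1 + x.2).
Proof.
move=> [u v] U [W gW /= WU].
have nW x : nbhs x [set x + w | w in [set w | W (2 *: w)]].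
  by exists [set w | W (2 *: w)]; [exact: goodZ|move=> w Ww; exists w].
exists (([set u + w | w in [set w | W (2 *: w)]]),
        ([set v + w | w in [set w | W (2 *: w)]])); first by split.
move=> [_ _] /= [[w Ww <-] [w' Ww' <-]]; rewrite addrACA.
by apply: WU; exact: good_half.
Qed.

Fact Lscale_continuous : continuous (fun z : R^o * L => z.1 *: z.2).
Proof.
move=> [a u] U [W gW /= WU].
pose M : R := 2 * (`|a| + 1).
have M0 : 0 < M by rewrite mulr_gt0// ltr_wpDl.
exists ([set b : R^o | W (2 *: ((b - a) *: u)) /\ `|b - a| < 1],
        [set u + w | w in [set w | W (M *: w)]]).
  split; last by exists [set w | W (M *: w)]; [exact: goodZ|move=> w Ww; exists w].
  apply: filterI; last first.
    by near=> b; rewrite distrC; near: b; exact: nbhsx_ballx.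
  have : (fun b : R^o => b - a) @ a --> (0 : R^o).
    by rewrite -(subrr a); apply: cvgB; [exact: cvg_id|exact: cvg_cst].
  move=> /(_ _ (good_absorb (goodZ 2 gW) u)); exact.
move=> [b _] /= [[Wb b1] [w Ww <-]].
have -> : b *: (u + w) = a *: u + ((b - a) *: u + b *: w).
  by rewrite scalerDr addrA -scalerDl (addrC a) subrK.
apply: WU; apply: good_half => //.
rewrite scalerA (_ : 2 * b = (2 * b / M) * M); last by rewrite divfK ?gt_eqF.
rewrite -scalerA; apply: good_balanced => //.
rewrite normrM normfV (gtr0_norm M0) ler_pdivrMr// mul1r normrM ger0_norm//.
rewrite ler_wpM2l// -[b](subrK a) addrC (le_trans (ler_normD _ _))// lerD2l.
exact: ltW.
Unshelve. all: by end_near. Qed.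

Fact Llocally_convex :
  exists2 B : set_system L, (forall b, b \in B -> convex_set b) & basis B.
Proof.
exists [set b | open b /\ convex_set b]; first by move=> b; rewrite inE => -[].
split; first by move=> b [].
move=> u U [W gW WU].
exists [set v | nbhs v [set u + w | w in W]]; last first.
  by move=> v /= /nbhs_singleton [w Ww <-]; exact: WU.
split; last by exists W => // w Ww; exists w.
split; first by rewrite openE => v /nbhs_interior.
move=> v1 v2 t; rewrite !inE /= => -[W1 g1 WW1] [W2 g2 WW2].
exists (W1 `&` W2); first exact: goodI.
move=> w [/WW1 [w1 Ww1 e1] /WW2 [w2 Ww2 e2]].
exists (t%:num *: w1 + (1 - t%:num) *: w2); first exact: (good_convex gW).
transitivity (t%:num *: (u + w1) + (1 - t%:num) *: (u + w2)).
  by rewrite !scalerDr addrACA -scalerDl (addrC t%:num) subrK scale1r.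
rewrite e1 e2 !scalerDr addrACA; congr (_ + _).
by rewrite -scalerDl (addrC t%:num) subrK scale1r.
Qed.

HB.instance Definition _ := PreTopologicalLmod_isTvs.Build R L
  Ladd_continuous Lscale_continuous Llocally_convex.
HB.instance Definition _ :=
  PreTopologicalNmodule_isTopologicalNmodule.Build L Ladd_continuous.
HB.instance Definition _ :=
  TopologicalNmodule_isTopologicalLmodule.Build R L Lscale_continuous.
HB.instance Definition _ := Uniform_isTvs.Build R L Llocally_convex.

Lemma delta_continuous : continuous delta.
Proof.
move=> x0 U [W gW WU]; have := good_delta gW 1 x0.
by apply: filterS => x; rewrite scale1r => /WU; rewrite addrC subrK.
Qed.

Lemma lift_continuous (E : tvsType R) (f : X -> E) :
  continuous f -> continuous (lift f).
Proof.
move=> cf u U fU.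
have [B Bconv [Bopen /(_ (0 : E)) B0]] := @locally_convex R E.
have : nbhs (0 : E) [set e | U (lift f u + e)].
  have /= := @add_continuous E (lift f u, 0) U; rewrite addr0 => /(_ fU).
  move=> [[/= P Q] [/= Pu Q0] PQ]; apply: filterS Q0 => e Qe.
  by apply: (PQ (_, _)); split => //; exact: nbhs_singleton.
move=> /B0 [V [BV V0] VU].
have nV : nbhs (0 : E) V by apply: open_nbhs_nbhs; split => //; exact: Bopen.
pose V' := V `&` [set e | V (- e)].
have nV' : nbhs (0 : E) V'.
  apply: filterI => //.
  by have := @opp_continuous E 0 V; rewrite oppr0; exact.
exists [set w | V' (lift f w)]; last first.
  by move=> w [Vw _] /=; rewrite linearD; exact: VU.
have Vconv e1 e2 (t : R) : V e1 -> V e2 -> 0 <= t -> t <= 1 ->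
    V (t *: e1 + (1 - t) *: e2).
  move=> V1 V2 t0 t1; have t01 : Itv.spec (@Itv.num_sem R)
    (Itv.Real (Interval (BSide true 0%Z) (BSide false 1%Z))) t.
    by apply/and3P; split => //=; rewrite ?ger0_real// in_itv /= t0 t1.
  have := Bconv V (mem_set BV) e1 e2 (Itv.Def t01) (mem_set V1) (mem_set V2).
  by rewrite inE.
split=> /=.
- move=> w1 w2 t [a1 b1] [a2 b2] t0 t1; rewrite linearD !linearZ /=.
  split; first exact: Vconv.
  by rewrite /= opprD -!scalerN; exact: Vconv.
- by move=> w [a b]; rewrite linearN; split => //=; rewrite opprK.
- move=> w; have /= := @scale_continuous R E (0, lift f w) V'.
  rewrite scale0r => /(_ nV') [[/= P Q] [/= P0 Qw] PQ].
  apply: filterS P0 => t Pt; rewrite linearZ /=.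
  by apply: (PQ (_, _)); split => //; exact: nbhs_singleton.
- move=> c x0.
  have : (fun x => c *: (f x - f x0)) @ x0 --> c *: (f x0 - f x0).
    apply: (@continuous_comp _ _ _ (fun x => f x - f x0) ( *:%R c)).
      apply: (@continuous_comp _ _ _ (fun x => (f x, f x0))
        (fun z : E * E => z.1 - z.2)); last exact: sub_continuous.
      by apply: cvg_pair; [exact: cf|exact: cvg_cst].
    apply: (@continuous_comp _ (R^o * E)%type _ (fun e : E => (c, e))
      (fun z => z.1 *: z.2)); last exact: scale_continuous.
    by apply: (@cvg_pair _ _ _ _ (nbhs (c : R^o))); [exact: cvg_cst|exact: cvg_id].
  rewrite subrr scaler0 => /(_ _ nV').
  rewrite /nbhs /=; apply: filterS => x.
  have -> : lift f (c *: (delta x - delta x0)) = c *: (f x - f x0).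
    by rewrite linearZ; congr (_ *: _); rewrite linearB; congr (_ - _);
      exact: lift_delta.
  by [].
Qed.

Hypothesis X_separated :
  forall x y : X, x <> y -> exists2 f : X -> R, continuous f & f x <> f y.

Lemma separate_fset (x0 : X) (A : seq X) : x0 \notin A ->
  exists f : X -> R, [/\ continuous f, f x0 != 0 & forall x, x \in A -> f x = 0].
Proof.
elim: A => [_|y A IH].
  by exists (fun=> 1); split; [move=> x; exact: cvg_cst|exact: oner_neq0|].
rewrite inE negb_or => /andP[/eqP x0y /IH[f [cf f0 fA]]].
have [g cg gxy] := X_separated x0y.
exists (fun x => f x * (g x - g y)); split.
- move=> x; apply: cvgM; first exact: cf.
  by apply: cvgB; [exact: cg|exact: cvg_cst].
- by rewrite mulf_neq0// subr_eq0; apply/eqP.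
- move=> x; rewrite inE => /orP[/eqP ->|/fA ->]; last by rewrite mul0r.
  by rewrite subrr mulr0.
Qed.

Lemma L_hausdorff : hausdorff_space L.
Proof.
move=> p q pq; apply/eqP; rewrite -subr_eq0; apply/negP => /negP pq0.
have [x0 px0] : exists x0, (p - q) x0 != 0.
  apply: contra_notP (negP pq0) => nex; apply/eqP/L_eqP => x.
  by apply: contrapT => /eqP px; apply: nex; exists x.
have [A uA] := L_supp (p - q).
have x0A : x0 \in A by apply: contraNT px0 => /uA ->.
have [|f [cf f0 fA]] := @separate_fset x0 (rem x0 A).
  by rewrite mem_rem_uniq ?fset_uniq// !inE eqxx.
have cl := @lift_continuous R^o f cf.
have : lift (f : X -> R^o) p = lift (f : X -> R^o) q.
  apply: Rhausdorff => P Q fP fQ.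
  by have [v [Pv Qv]] := pq _ _ (cl p P fP) (cl q Q fQ); exists (lift (f : X -> R^o) v).
move/eqP; rewrite -subr_eq0 -linearB /= (liftE _ uA) (bigD1_seq x0) ?fset_uniq//= big1_seq.
  by rewrite addr0 mulf_eq0 (negPf px0) (negPf f0).
move=> x /andP[xx0 xA]; rewrite fA ?scaler0//.
by rewrite mem_rem_uniq ?fset_uniq// !inE xx0.
Qed.

Lemma LP : free_lcs_axiom delta.
Proof.
split.
- exact: L_hausdorff.
- exact: delta_continuous.
- move=> x y /(congr1 (fun u : L => u x)) /=; rewrite eqxx.
  by have [//|_ /eqP] := eqVneq x y; rewrite oner_eq0.
- move=> u; have [A uA] := L_supp u; exists (size A).
  exists (fun i => u (tnth (in_tuple A) i)), (tnth (in_tuple A)).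
  by rewrite -{1}[u]lift_deltaK (liftE _ uA) big_tnth.
- move=> E f _ cf; exists (lift f : {linear L -> E}).
    exact: lift_continuous.
  exact: lift_delta.
Qed.

End FreeLcs.
End FreeLcs.

Lemma free_lcs_exists (R : realType) (X : topologicalType) :
  (forall x y : X, x <> y -> exists2 f : X -> R, continuous f & f x <> f y) ->
  inhabited (free_lcs R X).
Proof. by move=> Xsep; exists; exact: (FreeLcs (FreeLcs.LP Xsep)). Qed.

Lemma free_lcs_exists_metric (R : realType) (X : metricType R) (Y : set X) :
  inhabited (free_lcs R X) /\ inhabited (free_lcs R Y).
Proof.
have sep (x y : X) : x <> y -> exists2 f : X -> R, continuous f & f x <> f y.
  move=> xy; exists (mdist x).
    move=> z; apply/cvgrPdist_lt => /= e e0; near=> t.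
    have zt : mdist z t < e.
      have : ball z e t by near: t; exact: nbhsx_ballx.
      by rewrite ballEmdist.
    rewrite ltr_norml; apply/andP; split.
      by have := metric_triangle x z t; lra.
    by have := metric_triangle x t z; rewrite (metric_sym t z); lra.
  by rewrite mdistxx => /esym/mdist_positivity.
split; apply: free_lcs_exists => // x y xy.
have [|f cf fxy] := sep (set_val x) (set_val y).
  by move=> e; apply: xy; exact: val_inj.
exists (f \o set_val) => // z; apply: continuous_comp; last exact: cf.
exact: initial_continuous.
Unshelve. all: by end_near. Qed.

(* Main.v *)
Require Import Defs.
From HB Require Import structures.
From mathcomp Require Import all_boot all_order all_algebra.
From mathcomp Require Import all_classical all_reals all_analysis.
From mathcomp Require Import wochoice lra.

Set Implicit Arguments.
Unset Strict Implicit.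
Unset Printing Implicit Defensive.

Import Order.TTheory GRing.Theory Num.Theory.
Import numFieldNormedType.Exports.

Local Open Scope classical_set_scope.
Local Open Scope ring_scope.

(** Closed implies L-retract.  It is enough to extend the canonical map
[Y -> L(Y)] to a continuous map [X -> L(Y)]: by the universal property of
[L(X)] the extension linearizes to [r : L(X) -> L(Y)], and [r] is a left inverse
of the canonical map [j : L(Y) -> L(X)] because it is one on generators.  A
continuous left inverse forces [j] to be a topological embedding.  The extension
exists by Dugundji's theorem ([dugundji_extension]): a continuous map from a
closed subset of a metric space to a locally convex space extends to the whole
space.

Dugundji's theorem needs a partition of unity off [Y], i.e. some form of
A. H. Stone's paracompactness theorem.  Only a thin version of it is built here
([dugundji_system_exists]).  A point [x] off [Y] may be sent to those [y] in [Y]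
with [d(x, y) < 2 d(x, Y)].  The least such [y] for a well-order of [Y], call it
[a x], is a choice with the following coherence: if [a x] is admissible for [z]
and [a z] is admissible for [x], then [a x = a z].  Admissibility is an open
condition with a Lipschitz margin, so on the set [core n] of the points where
[a x] is admissible with margin at least [9 / (n + 1)], the map [a] is constant
at distances below [3 / (n + 1)].  Hence tents of radius [1 / (n + 1)] around
[core n] give, for each [n], a function [phi n] on whose support a choice of an
admissible point is locally constant.  The [phi n] tend to 0 uniformly and their
supremum is positive off [Y], so the functions [max 0 (phi n - sup phi / 2)]
form a family which is locally finite off [Y] and has a positive member at each
of these points; they are the weights of the convex combinations that define the
extension.

L-retract implies l-embedded.  A function [f] on [Y] has a linear extension
[f_#] to [L(Y)], and [x |-> f_# (r x)] extends [f] to [X].  As [r x] is a linear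
combination of finitely many points of [Y], the value at [x] is a fixed finite
linear combination of values of [f], whence continuity for pointwise
convergence.

l-embedded implies closed.  Let [x] be a point of the closure of [Y] outside
[Y].  The functional [f |-> phi f x] is continuous for pointwise convergence, so
it vanishes on all [f] that vanish on some finite subset [A] of [Y].  The
product of the distances to the points of [A] restricts to such an [f]; its
extension [phi f] agrees with the product on [Y], hence at [x], where the
product is not zero. *)

(** * Coherent choices *)

(** Choosing the least admissible index for a well-order makes the choices
depend on the point in a rigid way: two points, each of which admits the choice
made at the other, are assigned the same index.  This is the
combinatorial core of the paracompactness of metric spaces. *)
Lemma coherent_choice (T : Type) (I : eqType) (i0 : I) (P : T -> I -> Prop) :
  exists a : T -> I, (forall t i, P t i -> P t (a t)) /\
    (forall t t', P t (a t') -> P t' (a t) -> a t = a t').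
Proof.
have [le wo] := well_ordering_principle I.
have le_refl i : le i i.
  have [|z [[zi lez] _]] := wo (pred1 i); first by exists i; rewrite inE.
  by have := lez _ zi; move: zi; rewrite inE => /eqP ->.
have le_anti i j : le i j -> le j i -> i = j.
  move=> ij ji; have [|z [_ uz]] := wo (pred2 i j).
    by exists i; rewrite inE eqxx.
  apply: etrans (esym (uz i _)) (uz j _); split; rewrite ?inE ?eqxx ?orbT//.
  - by move=> k; rewrite inE => /orP[/eqP ->|/eqP ->].
  - by move=> k; rewrite inE => /orP[/eqP ->|/eqP ->].
have minP t : exists i,
    (forall j, P t j -> P t i) /\ (forall j, P t j -> le i j).
  have [[j Ptj]|nP] := pselect (exists j, P t j); last first.
    by exists i0; split=> j Ptj; case: nP; exists j.
  have [|z [[Ptz lez] _]] := wo [pred i | `[< P t i >]].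
    by exists j; apply/asboolP.
  exists z; split=> [_ _|k Ptk]; first exact/asboolP.
  by apply: lez; exact/asboolP.
have [a aP] := choice minP; exists a; split=> [t i|t t' tt' t't].
  exact: (aP t).1.
by apply: le_anti; [exact: (aP t).2|exact: (aP t').2].
Qed.

(** * Suprema of Lipschitz functions *)

Section Lipschitz.
Context (R : realType) (X : metricType R).

Definition lip1 (f : X -> R) := forall x z, f x <= f z + mdist x z.

Lemma lip1_continuous (f : X -> R) : lip1 f -> continuous f.
Proof.
move=> lf x; apply/cvgrPdist_lt => /= e e0; near=> z.
have xz : mdist x z < e.
  have : ball x e z by near: z; exact: nbhsx_ballx.
  by rewrite ballEmdist.
have := lf x z; have := lf z x; rewrite (metric_sym z x) => ? ?.
by rewrite ltr_norml; apply/andP; split; lra.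
Unshelve. all: by end_near. Qed.

Lemma mdist_lip1 (a : X) : lip1 (mdist ^~ a).
Proof. by move=> x z; rewrite addrC; exact: metric_triangle. Qed.

Section envelope.
Context (I : Type) (i0 : I) (h : I -> X -> R) (M : R)
  (h_le : forall i x, h i x <= M).

Definition sup_fun (x : X) : R := sup (range (h ^~ x)).

Let has_sup_h x : has_sup (range (h ^~ x)).
Proof.
split; first by exists (h i0 x), i0.
by exists M => _ [i _ <-].
Qed.

Lemma sup_fun_ge i x : h i x <= sup_fun x.
Proof. by apply: ub_le_sup; [exact: (has_sup_h x).2|exists i]. Qed.

Lemma sup_fun_le x (c : R) : (forall i, h i x <= c) -> sup_fun x <= c.
Proof.
by move=> ch; apply: ge_sup; [exact: (has_sup_h x).1|move=> _ [i _ <-]].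
Qed.

Lemma sup_fun_gt x (c : R) : c < sup_fun x -> exists i, c < h i x.
Proof.
rewrite -subr_gt0 => /sup_adherent/(_ (has_sup_h x))[_ [i _ <-]].
by rewrite opprB addrC subrK; exists i.
Qed.

Lemma sup_fun_lip1 : (forall i, lip1 (h i)) -> lip1 sup_fun.
Proof.
move=> lh x z; apply: sup_fun_le => i.
by rewrite (le_trans (lh i x z))// lerD2r sup_fun_ge.
Qed.

End envelope.
End Lipschitz.

(** * A Dugundji system off a closed set *)

Section DugundjiSystem.
Context (R : realType) (X : metricType R) (Y : set X).

(** The distance from [x] to [Y], as the opposite of a supremum so that the
lemmas on suprema of Lipschitz functions apply. *)
Definition dist_to (x : X) : R :=
  - sup_fun (fun (y : Y) z => - mdist z (set_val y)) x.

(** The data of Dugundji's extension: at a point [x] off [Y] the value of the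
extension will be the average of the [f (p n x)] with weights [w n x].  The last
condition is what makes the average converge to [f y] when [x] tends to a point
[y] of [Y]. *)
Record dugundji_system (w : nat -> X -> R) (p : nat -> X -> Y) : Prop := {
  weight_ge0 : forall n x, 0 <= w n x ;
  weight_continuous : forall n, continuous (w n) ;
  weight_ex : forall x, ~ Y x -> exists n, 0 < w n x ;
  weight_locally_finite : forall x, ~ Y x ->
    exists N, \forall z \near x, forall n, (N <= n)%N -> w n z = 0 ;
  point_locally_constant : forall n x, ~ Y x ->
    exists y, \forall z \near x, w n z = 0 \/ p n z = y ;
  point_near : forall n x, 0 < w n x ->
    mdist x (set_val (p n x)) < 2 * dist_to x
}.

Let ndist_le0 (y : Y) x : - mdist x (set_val y) <= 0 :> R.
Proof. by rewrite oppr_le0 mdist_ge0. Qed.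

Lemma dist_to_le (y : Y) x : dist_to x <= mdist x (set_val y).
Proof. by rewrite lerNl; exact: (sup_fun_ge y ndist_le0). Qed.

Context (y0 : Y).

Let dist_to_lip x z : dist_to z <= dist_to x + mdist x z.
Proof.
have h (y : Y) : lip1 (fun x => - mdist x (set_val y)).
  move=> x1 z1; have := metric_triangle z1 x1 (set_val y).
  by rewrite (metric_sym z1 x1); lra.
by have := sup_fun_lip1 y0 ndist_le0 h x z; rewrite /dist_to; lra.
Qed.

Context (closedY : closed Y).

Lemma dist_to_gt0 x : ~ Y x -> 0 < dist_to x.
Proof.
move=> nYx; have : nbhs x (~` Y).
  by apply: open_nbhs_nbhs; split => //; exact: closed_openC.
move=> /nbhs_ballP[e /= e0]; rewrite ballEmdist => eY.
apply: lt_le_trans e0 _; rewrite lerNr.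
apply: (sup_fun_le y0 ndist_le0) => y; rewrite lerNr opprK leNgt.
by apply/negP => /eY; apply; exact: set_valP.
Qed.

(* [y] is admissible for [x] when the slack is positive *)
Let slack (y : Y) x := 2 * dist_to x - mdist x (set_val y).

Let slack_lip (y : Y) x z : slack y x <= slack y z + 3 * mdist x z.
Proof.
have := dist_to_lip z x.
have := metric_triangle z x (set_val y); rewrite (metric_sym z x) /slack; lra.
Qed.

Let slack_ex x : ~ Y x -> exists y, 0 < slack y x.
Proof.
move=> nYx; have dx0 := dist_to_gt0 nYx.
have [|y yx] := @sup_fun_gt _ _ _ y0 _ _ ndist_le0 x (- (2 * dist_to x)).
  by rewrite -[ltRHS]opprK -/(dist_to x); lra.
by exists y; rewrite subr_gt0 -ltrN2.
Qed.

Context (a : X -> Y)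
  (a_slack : forall x y, 0 < slack y x -> 0 < slack (a x) x)
  (a_coherent : forall x z,
    0 < slack (a z) x -> 0 < slack (a x) z -> a x = a z).

Let scale (n : nat) : R := n.+1%:R^-1.

Let scale_gt0 n : 0 < scale n.
Proof. by rewrite invr_gt0. Qed.

Let scale_le1 n : scale n <= 1.
Proof. by rewrite invf_le1// ler1n. Qed.

(* The slack is 3-Lipschitz.  The margin 9 keeps it positive on the ball of
   radius [3 * scale n].  That radius is what local constancy needs: two points
   at distance less than [scale n], each at distance less than [scale n] from the
   core, have core neighbours that are less than [3 * scale n] apart. *)
Let core n : set X := [set c | 9 * scale n <= slack (a c) c].

Let core_sep n c c' : core n c -> core n c' -> mdist c c' < 3 * scale n ->
  a c = a c'.
Proof.
rewrite /core /= => nc nc' cc'; apply: a_coherent.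
- by have := slack_lip (a c') c' c; rewrite (metric_sym c' c); lra.
- by have := slack_lip (a c) c c'; lra.
Qed.

(* The index [None] bounds the supremum below by 0 and keeps the family nonempty
   when the core is empty. *)
Let tent n (i : option {c | core n c}) (x : X) : R :=
  if i is Some c then scale n - mdist x (sval c) else 0.

Let tent_le n i x : @tent n i x <= scale n.
Proof. by case: i => [c|] /=; rewrite ?gerBl ?mdist_ge0// ltW. Qed.

Let tent_lip1 n i : lip1 (@tent n i).
Proof.
case: i => [c|] x z /=; last by rewrite add0r mdist_ge0.
by have := metric_triangle z x (sval c); rewrite (metric_sym z x); lra.
Qed.

Let phi n : X -> R := sup_fun (@tent n).

Let phi_ge0 n x : 0 <= phi n x.
Proof. exact: (sup_fun_ge None (@tent_le n) None). Qed.

Let phi_le n x : phi n x <= scale n.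
Proof. by apply: (sup_fun_le None (@tent_le n)). Qed.

Let phi_le1 n x : phi n x <= 1.
Proof. exact: le_trans (phi_le n x) (scale_le1 n). Qed.

Let phi_lip1 n : lip1 (phi n).
Proof. exact: (sup_fun_lip1 None (@tent_le n)). Qed.

Let phi_gt0 n x : 0 < phi n x -> exists2 c, core n c & mdist x c < scale n.
Proof.
move=> /(sup_fun_gt None (@tent_le n))[[[c nc]|]]; last by rewrite ltxx.
by move=> /=; rewrite subr_gt0; exists c.
Qed.

Let phi_max : X -> R := sup_fun phi.

Let phi_max_lip1 : lip1 phi_max.
Proof. exact: (sup_fun_lip1 0%N phi_le1). Qed.

Let phi_max_gt0 x : ~ Y x -> 0 < phi_max x.
Proof.
move=> /slack_ex[y /a_slack ax].
have [n nx] : exists n, core n x.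
  have ax9 : 0 < slack (a x) x / 9 by rewrite divr_gt0.
  have [n _ /(_ n (leqnn _))] := near_infty_natSinv_lt (PosNum ax9).
  by move=> /=; rewrite ltr_pdivlMr// mulrC => /ltW h; exists n.
apply: lt_le_trans (scale_gt0 n) _.
apply: le_trans _ (sup_fun_ge 0%N phi_le1 n x).
rewrite -[leLHS]subr0 -(mdistxx x).
exact: (sup_fun_ge None (@tent_le n) (Some (exist _ x nx))).
Qed.

(* Subtracting half of the supremum cuts off all large [n] near a point off [Y],
   because [phi n <= scale n], and leaves some positive weight at each such
   point. *)
Let weight n x := Num.max 0 (phi n x - phi_max x / 2).

Let phi_max_ge0 x : 0 <= phi_max x.
Proof. exact: le_trans (phi_ge0 0 x) (sup_fun_ge 0%N phi_le1 0 x). Qed.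

Let weight_gt0_phi n x : 0 < weight n x -> 0 < phi n x.
Proof.
rewrite lt_max ltxx subr_gt0; apply: le_lt_trans.
by rewrite divr_ge0.
Qed.

(* the common value of [a] at all core points near [x]; the default [x] is
   never reached when [phi n x] is positive *)
Let anchor n x : Y :=
  a (if pselect (exists2 c, core n c & mdist x c < scale n) is left e
     then s2val (cid2 e) else x).

Let anchorP n x : 0 < phi n x ->
  exists c, [/\ core n c, mdist x c < scale n & anchor n x = a c].
Proof.
move=> /phi_gt0 e; rewrite /anchor; case: pselect => // e'.
by case: cid2 => /= c; exists c.
Qed.

Lemma coherent_dugundji_system :
  exists (w : nat -> X -> R) (p : nat -> X -> Y), dugundji_system w p.
Proof.
have phi_cont n := lip1_continuous (phi_lip1 n).
have phi_max_cont := lip1_continuous phi_max_lip1.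
have near_small x (e : R) (f : X -> R) : continuous f -> f x < e ->
    \forall z \near x, f z < e.
  by move=> cf fe; exact: cf (open_nbhs_nbhs (conj (@open_lt _ e) fe)).
have near_large x (e : R) (f : X -> R) : continuous f -> e < f x ->
    \forall z \near x, e < f z.
  by move=> cf fe; exact: cf (open_nbhs_nbhs (conj (@open_gt _ e) fe)).
have diff_cont n : continuous (fun x => phi n x - phi_max x / 2).
  move=> x; apply: cvgB; first exact: phi_cont.
  by apply: cvgMl; exact: phi_max_cont.
exists weight, anchor; split.
- by move=> n x; rewrite le_max lexx.
- move=> n x; apply: (@continuous_max R X (cst 0)
    (fun x => phi n x - phi_max x / 2)); first exact: cvg_cst.
  exact: diff_cont.
- move=> x /phi_max_gt0 M0.
  have [|n nx] := @sup_fun_gt _ _ _ 0%N _ _ phi_le1 x (phi_max x / 2).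
    by rewrite -/phi_max; lra.
  by exists n; rewrite lt_max subr_gt0 nx orbT.
- move=> x /phi_max_gt0 M0; have M4 : 0 < phi_max x / 4 by rewrite divr_gt0.
  have [N _ NM] := near_infty_natSinv_lt (PosNum M4).
  exists N; have : \forall z \near x, phi_max x / 2 < phi_max z.
    by apply: near_large => //; lra.
  apply: filterS => z xz n Nn; apply/max_idPl.
  have := phi_le n z; have : scale n < phi_max x / 4 by exact: NM.
  by lra.
- move=> n x /phi_max_gt0 M0.
  have [px|px] := ltP 0 (phi n x); last first.
    exists y0.
    have : \forall z \near x, phi n z - phi_max z / 2 < 0.
      by apply: near_small => //; lra.
    by apply: filterS => z /ltW z0; left; exact/max_idPl.
  exists (anchor n x).
  have : \forall z \near x, mdist x z < scale n /\ 0 < phi n z.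
    apply: filterI; last exact: near_large.
    apply/nbhs_ballP; exists (scale n); first exact: scale_gt0.
    by rewrite ballEmdist.
  apply: filterS => z [xz /anchorP[c [nc zc ->]]]; right.
  have [c' [nc' xc' ->]] := anchorP px.
  apply: core_sep nc nc' _.
  have := metric_triangle c z c'; have := metric_triangle z x c'.
  by rewrite (metric_sym c z) (metric_sym z x); lra.
- move=> n x /weight_gt0_phi/anchorP[c [nc xc ->]].
  move: nc; rewrite /core /= => nc.
  have := slack_lip (a c) c x; have := scale_gt0 n.
  by rewrite (metric_sym c x) {2}/slack; lra.
Qed.

End DugundjiSystem.

Lemma dugundji_system_exists (R : realType) (X : metricType R) (Y : set X) :
  closed Y -> Y !=set0 ->
  exists (w : nat -> X -> R) (p : nat -> X -> Y), dugundji_system w p.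
Proof.
move=> closedY [y Yy]; pose y0 : Y := exist _ y (mem_set Yy).
have [a [aP a_coh]] := coherent_choice y0
  (fun x (y : Y) => 0 < 2 * dist_to Y x - mdist x (set_val y)).
exact (coherent_dugundji_system y0 closedY aP a_coh).
Qed.

(** * Dugundji's extension theorem *)

Lemma big_ord_extend0 (V : nmodType) (m n : nat) (G : nat -> V) :
  (n <= m)%N -> (forall i, (n <= i)%N -> G i = 0) ->
  \sum_(i < m) G i = \sum_(i < n) G i.
Proof.
move=> nm G0; rewrite (big_ord_widen m G nm).
rewrite [LHS](bigID (fun i : 'I_m => (i < n)%N)) /=.
by rewrite [X in _ + X]big1 ?addr0// => i; rewrite -leqNgt => /G0.
Qed.

Section Dugundji.
Context (R : realType) (E : tvsType R).

Lemma locally_convexP (e : E) (U : set E) : nbhs e U ->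
  exists V : set E, [/\ nbhs e V, V `<=` U & forall u v (s t : R),
    V u -> V v -> 0 <= s -> 0 <= t -> s + t = 1 -> V (s *: u + t *: v)].
Proof.
have [B Bconv [Bopen Bbasis]] := @locally_convex R E.
move=> /Bbasis[V [BV Ve] VU]; exists V; split=> //.
  by apply: open_nbhs_nbhs; split => //; exact: Bopen.
move=> u v s t Vu Vv s0 t0 st.
have s1 : s <= 1 by lra.
have s01 : Itv.spec (@Itv.num_sem R)
    (Itv.Real (Interval (BSide true 0%Z) (BSide false 1%Z))) s.
  apply/and3P; split => //=; rewrite ?ger0_real// in_itv /= s0 s1.
have := Bconv V (mem_set BV) u v (Itv.Def s01) (mem_set Vu) (mem_set Vv).
move/set_mem; rewrite (_ : t = 1 - s)//.
by rewrite -st addrC addKr.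
Qed.

(** Membership is asked of [v n] at positive weights only, since the points of a
Dugundji system are close to [Y] exactly where their weight is positive. *)
Lemma convex_combination_mem (V : set E) (w : nat -> R) (v : nat -> E) N :
  (forall u v (s t : R), V u -> V v -> 0 <= s -> 0 <= t -> s + t = 1 ->
    V (s *: u + t *: v)) ->
  (forall n, 0 <= w n) -> (forall n, 0 < w n -> V (v n)) ->
  0 < \sum_(n < N) w n ->
  V ((\sum_(n < N) w n)^-1 *: \sum_(n < N) w n *: v n).
Proof.
move=> Vconv w0 Vv; elim: N => [|N IH]; first by rewrite big_ord0 ltxx.
rewrite !big_ord_recr /=; set W := \sum_(n < N) w n in IH *.
have := w0 N; rewrite le_eqVlt => /predU1P[<-|wN].
  by rewrite addr0 scale0r addr0.
have : 0 <= W by exact: sumr_ge0.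
rewrite le_eqVlt => /predU1P[W0|W_gt0] T0.
  rewrite big1 => [|i _].
    by rewrite -W0 !add0r scalerA mulVf ?gt_eqF// scale1r; exact: Vv.
  have : \sum_(n < N) w n == 0 by rewrite -/W -W0.
  rewrite psumr_eq0 => [/allP/(_ i)|*]; last exact: w0.
  by rewrite mem_index_enum => /(_ isT)/eqP ->; rewrite scale0r.
set S := \sum_(n < N) _ *: _ in IH *.
have -> : (W + w N)^-1 *: (S + w N *: v N) =
    (W / (W + w N)) *: (W^-1 *: S) + (w N / (W + w N)) *: v N.
  rewrite scalerDr !scalerA; congr (_ *: _ + _ *: _); last exact: mulrC.
  by rewrite mulrAC divff ?mul1r// gt_eqF.
apply: Vconv; [exact: IH|exact: Vv| | |].
- by rewrite divr_ge0// ltW.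
- by rewrite divr_ge0// ltW.
- by rewrite -mulrDl divff// gt_eqF.
Qed.

Lemma cvg_scale (T : Type) (F : set_system T) (k : T -> R) (u : T -> E)
    (k0 : R) (u0 : E) : Filter F ->
  k @ F --> k0 -> u @ F --> u0 -> (fun t => k t *: u t) @ F --> k0 *: u0.
Proof.
move=> FF kk uu; have /= := @scale_continuous R E (k0, u0).
apply: (@cvg_comp _ _ _ (fun t => (k t : R^o, u t))).
exact: (@cvg_pair _ _ _ _ (nbhs (k0 : R^o))).
Qed.

(** Off [Y] the extension is locally a finite sum of continuous weights times
constant vectors, divided by the total weight.  Near a point [y] of [Y] it is a
convex combination of values of [f] at points three times as far from [y] at
most, so local convexity of the target gives continuity there. *)
Lemma dugundji_extension (X : metricType R) (Y : set X) (f : Y -> E) :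
  closed Y -> continuous f ->
  exists2 F : X -> E, continuous F & forall y : Y, F (set_val y) = f y.
Proof.
move=> closedY cf; have [Y0|nY0] := pselect (Y !=set0); last first.
  exists (cst 0); first by move=> x; exact: cvg_cst.
  by move=> y; case: nY0; exists (set_val y); exact: set_valP.
have [w [p [w_ge0 w_cont w_ex w_fin p_loc p_near]]] :=
  dugundji_system_exists closedY Y0.
have Nex x : exists N, ~ Y x -> forall n, (N <= n)%N -> w n x = 0.
  have [Yx|/[dup] nYx /w_fin[N /nbhs_singleton wN]] := pselect (Y x).
    by exists 0%N.
  by exists N.
have [N wN] := choice Nex.
(* Averages over the first [M] indices, for [M] past the last positive weight,
   do not depend on [M]: locally on the complement of [Y] one [M] will do. *)
pose avg M x := (\sum_(n < M) w n x)^-1 *: \sum_(n < M) w n x *: f (p n x).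
have avg_stable M M' x : (M <= M')%N -> (forall n, (M <= n)%N -> w n x = 0) ->
    avg M' x = avg M x.
  move=> MM' wM; rewrite /avg; congr (_^-1 *: _).
    exact: (@big_ord_extend0 _ _ _ (w ^~ x) MM').
  apply: (@big_ord_extend0 _ _ _ (fun i => w i x *: f (p i x)) MM').
  by move=> i /wM ->; rewrite scale0r.
have sum_gt0 M x : ~ Y x -> (forall n, (M <= n)%N -> w n x = 0) ->
    0 < \sum_(n < M) w n x.
  move=> nYx wM; have [n wn] := w_ex x nYx.
  have nM : (n < M)%N.
    by rewrite ltnNge; apply/negP => /wM w0; rewrite w0 ltxx in wn.
  by rewrite (bigD1 (Ordinal nM))//= ltr_pwDl//; exact: sumr_ge0.
pose F x := if pselect (Y x) is left Yx then f (exist _ x (mem_set Yx))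
            else avg (N x) x.
have FY (y : Y) : F (set_val y) = f y.
  rewrite /F; case: pselect => [Yy|]; last by move/(_ (set_valP y)).
  by congr f; exact: val_inj.
have F_off x M : ~ Y x -> (forall n, (M <= n)%N -> w n x = 0) ->
    F x = avg M x.
  move=> nYx wM; rewrite -(avg_stable _ _ _ (leq_maxl M (N x)))//.
  rewrite (avg_stable _ _ _ (leq_maxr M (N x))); last exact: wN.
  by rewrite /F; case: pselect.
exists F => // x; have [Yx|nYx] := pselect (Y x); last first.
  have [M nearM] := w_fin x nYx.
  have [v vP] := choice (p_loc ^~ x ^~ nYx).
  have nearF : \forall z \near x,
      (\sum_(n < M) w n z)^-1 *: (\sum_(n < M) w n z *: f (v n)) = F z.
    have offY : \forall z \near x, ~ Y z.
      by apply: open_nbhs_nbhs; split => //; exact: closed_openC.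
    have loc : \forall z \near x, forall i : 'I_M, w i z = 0 \/ p i z = v i.
      by apply: filter_forall => i; exact: vP.
    apply: filterS3 offY nearM loc => z nYz Mz loc.
    rewrite (F_off z M nYz Mz); congr (_ *: _); apply: eq_bigr => i _.
    by have [->|->] := loc i; rewrite ?scale0r.
  apply: cvg_trans (near_eq_cvg nearF) _.
  rewrite -(nbhs_singleton nearF).
  apply: cvg_scale.
    apply: cvgV; last first.
      by apply: cvg_big => [|i _]; [exact: add_continuous|exact: w_cont].
    by rewrite gt_eqF// sum_gt0//; exact: nbhs_singleton nearM.
  apply: cvg_big => [|i _]; first exact: add_continuous.
  by apply: cvg_scale; [exact: w_cont|exact: cvg_cst].
pose y : Y := exist _ x (mem_set Yx).
have -> : x = set_val y by [].
move=> U; rewrite FY => /locally_convexP[V [Vy VU Vconv]].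
have [e e0 eV] : exists2 e : R, 0 < e &
    forall z : Y, mdist x (set_val z) < e -> V (f z).
  have [_ [[A oA <-] Ax AV]] := cf y V Vy.
  have /nbhs_ballP[e /= e0] : nbhs x A by exact: open_nbhs_nbhs.
  by rewrite ballEmdist => eA; exists e => // z /eA; exact: AV.
apply/nbhs_ballP; exists (e / 3); first by rewrite /= divr_gt0.
rewrite ballEmdist => z /= xz; apply: VU.
have [Yz|nYz] := pselect (Y z).
  have -> : z = set_val (exist _ z (mem_set Yz) : Y) by [].
  by rewrite FY; apply: eV => /=; lra.
rewrite (F_off z (N z) nYz (wN z nYz)).
apply: (@convex_combination_mem V (w ^~ z) (fun n => f (p n z))) => //;
  last exact: sum_gt0 nYz (wN z nYz).
move=> n /p_near pz; apply: eV.
(* [d(x, p n z) <= d(x, z) + d(z, p n z) < 3 d(x, z)]: hence the [e / 3] *)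
have := metric_triangle x z (set_val (p n z)).
by have := dist_to_le y z; rewrite /= (metric_sym z x); lra.
Qed.

End Dugundji.

(** * Free locally convex spaces and spaces of continuous functions *)

Section FreeLcsTheory.
Context (R : realType) (X : topologicalType) (LX : free_lcs R X).

Lemma free_lcs_linear_ext (E : lmodType R) (g h : {linear LX -> E}) :
  (forall x, g (free_lcs_delta LX x) = h (free_lcs_delta LX x)) -> g =1 h.
Proof.
move=> gh u; have [n [a [x ->]]] := free_lcs_span (free_lcsP LX) u.
by rewrite !linear_sum; apply: eq_bigr => i _; rewrite !linearZ /= gh.
Qed.

End FreeLcsTheory.

Lemma cvg_initialP (S : choiceType) (T : topologicalType) (f : S -> T)
    (F : set_system S) (s : S) : Filter F ->
  F --> (s : initial_topology f) <-> f @ F --> f s.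
Proof.
move=> FF; split=> [Fs|fFs].
  exact: cvg_trans (cvg_app f Fs) (@initial_continuous _ _ f s).
move=> A [_ [[B oB <-] Bs BA]]; apply: filterS BA _.
by apply: fFs; exact: open_nbhs_nbhs.
Qed.

Section CpTheory.
Context (R : realType) (X : topologicalType).

Lemma Cp_continuous (f : Cp R X) : continuous f.
Proof. by case: f => f /= /set_mem. Qed.

(** The topology of [Cp R X] is initial for the inclusion into a product, which
is itself a supremum of initial topologies along the projections; at both levels
convergence is tested after composition. *)
Lemma cvg_CpP (T : Type) (F : set_system T) (f : T -> Cp R X) (g : Cp R X) :
  Filter F -> f @ F --> g <-> forall x, (fun t => f t x) @ F --> g x.
Proof.
move=> FF; split=> [fg x|fg].
  have h : (fun t => (f t : {ptws X -> R})) @ F --> (g : {ptws X -> R}).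
    by have /cvg_initialP := fg.
  exact: cvg_trans (cvg_app (proj x) h) (@proj_continuous _ _ x _).
apply/cvg_initialP; apply/cvg_sup => x; apply/cvg_initialP.
exact: fg.
Qed.

Lemma Cp_eval_continuous (x : X) : continuous (fun f : Cp R X => f x).
Proof.
by move=> f; apply: (cvg_CpP id f (nbhs_filter f)).1; exact: cvg_id.
Qed.

End CpTheory.

(** * The three implications *)

(** A continuous extension of [Y -> L(Y)] to [X] linearizes to a left inverse [r]
of [j].  Then [j] is injective, and an open [U] is the preimage under [j] of the
open set [r @^-1` U]. *)
Lemma closed_L_retract (R : realType) (X : metricType R) (Y : set X)
    (LX : free_lcs R X) (LY : free_lcs R Y) :
  closed Y -> L_retract LX LY.
Proof.
move=> closedY.
have [|j cj jE] := free_lcs_lift (free_lcsP LY)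
    (free_lcs_hausdorff (free_lcsP LX)) (f := free_lcs_delta LX \o set_val).
  move=> y; apply: continuous_comp; first exact: initial_continuous.
  exact: free_lcs_continuous (free_lcsP LX) _.
have [F cF FE] :=
  dugundji_extension closedY (free_lcs_continuous (free_lcsP LY)).
have [r cr rE] :=
  free_lcs_lift (free_lcsP LX) (free_lcs_hausdorff (free_lcsP LY)) cF.
have jK : cancel j r.
  have jrE := @free_lcs_linear_ext R Y LY LY (r \o j) idfun.
  by apply: jrE => y; rewrite /= jE /= rE FE.
split; last by exists j, r; split.
exists j; split=> //; first exact: can_inj jK.
move=> U; split=> [oU|[V oV <-]]; last by move/continuousP: cj; apply.
exists (r @^-1` U); first by move/continuousP: cr; apply.
by apply/seteqP; split=> u /=; rewrite jK.
Qed.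

(** The extender is [f |-> f_# \o r \o delta_X].  Expanding [r (delta_X x)] in
the generators of [L(Y)] shows at once that it is linear in [f], although [f_#]
is obtained by choice, and that it is continuous. *)
Lemma L_retract_ell_embedded (R : realType) (X : topologicalType) (Y : set X)
    (LX : free_lcs R X) (LY : free_lcs R Y) :
  L_retract LX LY -> ell_embedded R Y.
Proof.
move=> [_ [j [r [jE cr jK]]]].
have sharp_ex (f : Cp R Y) : {g : {linear LY -> R^o} | continuous g
    & forall y, g (free_lcs_delta LY y) = f y}.
  apply: cid2; apply: (free_lcs_lift (free_lcsP LY)); first exact: Rhausdorff.
  exact: Cp_continuous.
pose sharp f := s2val (sharp_ex f).
have sharp_cont f : continuous (sharp f) by exact: (s2valP (sharp_ex f)).
have sharpE f y : sharp f (free_lcs_delta LY y) = f y.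
  exact: (s2valP' (sharp_ex f)).
have phi_in f :
    (fun x => sharp f (r (free_lcs_delta LX x))) \in @continuous_fun R X.
  apply/mem_set => x.
  apply: (@continuous_comp _ _ _ (r \o free_lcs_delta LX) (sharp f)).
    apply: continuous_comp; last exact: cr.
    exact: free_lcs_continuous (free_lcsP LX) _.
  exact: sharp_cont.
pose phi f := MkCp (phi_in f).
have sharp_expand u : exists n (a : 'I_n -> R) (y : 'I_n -> Y),
    forall f, sharp f u = \sum_(i < n) a i * f (y i).
  have [n [a [y ->]]] := free_lcs_span (free_lcsP LY) u.
  exists n, a, y => f; rewrite linear_sum; apply: eq_bigr => i _.
  by rewrite linearZ /= sharpE.
have phi_lin : linear phi.
  move=> c f g; apply: val_inj; apply/funext => x /=.
  have [n [a [y E]]] := sharp_expand (r (free_lcs_delta LX x)).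
  rewrite -[RHS]/(c * sharp f _ + sharp g _) !E mulr_sumr -big_split /=.
  apply: eq_bigr => i _; rewrite -[X in a i * X]/(c * f (y i) + g (y i)).
  by rewrite mulrDr mulrCA.
pose phi' : {linear Cp R Y -> Cp R X} :=
  HB.pack phi (GRing.isLinear.Build R (Cp R Y) (Cp R X) *:%R phi phi_lin).
exists phi'; split=> [f|f y]; last by rewrite /= -jE jK sharpE.
apply/(cvg_CpP _ _ (nbhs_filter f)) => x /=.
have [n [a [y E]]] := sharp_expand (r (free_lcs_delta LX x)).
rewrite E; under eq_fun do rewrite E.
apply: cvg_big => [|i _]; first exact: add_continuous.
apply: cvgM; first exact: cvg_cst.
exact: Cp_eval_continuous.
Qed.

Lemma ell_embedded_closed (R : realType) (X : metricType R) (Y : set X) :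
  ell_embedded R Y -> closed Y.
Proof.
move=> [phi [cphi phiE]] x clx; apply: contrapT => nYx.
pose vanish (A : seq Y) : set (Cp R Y) :=
  [set f | forall y, y \in A -> f y = 0].
(* The sets [vanish A] generate a filter that tends to 0 pointwise, so [phi f x]
   is bounded by 1 on some [vanish A]; that set being closed under scaling, the
   bound forces [phi f x = 0]. *)
have [A phiA] : exists A, forall f, vanish A f -> phi f x = 0.
  pose F : set_system (Cp R Y) := filter_from setT vanish.
  have FF : Filter F.
    apply: filter_from_filter; first by exists [::].
    move=> A B _ _; exists (A ++ B) => // f fAB.
    by split=> y yA; apply: fAB; rewrite mem_cat yA ?orbT.
  have F0 : F --> (0 : Cp R Y).
    apply/(cvg_CpP id 0 FF) => y U /nbhs_singleton U0.
    exists [:: y] => // f /(_ y).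
    by rewrite mem_head => /(_ isT) /= ->.
  have : phi @ F --> phi 0 by apply: cvg_trans (cphi 0); exact: cvg_app.
  move=> /(cvg_CpP _ _ FF)/(_ x)/cvgrPdist_lt/(_ 1 ltr01)[A _ phiA].
  exists A => f fA; apply: contrapT => /eqP phi0.
  have : vanish A ((phi f x)^-1 *: f).
    move=> y /fA fy; rewrite -[LHS]/((phi f x)^-1 * f y) fy; exact: mulr0.
  move/phiA => /=; rewrite linear0 linearZ.
  rewrite -[X in `|_ - X|]/((phi f x)^-1 * phi f x) mulVf//.
  by rewrite -[X in `|X - _|]/0 sub0r normrN1 ltxx.
pose g z := \prod_(y <- A) mdist z (set_val y).
have cg : continuous g.
  move=> z; apply: cvg_big => [|y _]; first exact: mul_continuous.
  exact: lip1_continuous (@mdist_lip1 _ _ _) z.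
have gY_in : g \o set_val \in @continuous_fun R Y.
  apply/mem_set => y; apply: continuous_comp; last exact: cg.
  exact: initial_continuous.
have gx : g x != 0.
  rewrite prodf_seq_neq0; apply/allP => y _ /=; rewrite gt_eqF// mdist_gt0.
  by apply/eqP => xy; apply: nYx; rewrite xy; exact: set_valP.
have phig : phi (MkCp gY_in) x = 0.
  apply: phiA => y yA /=; rewrite /g (big_rem y)//= mdistxx mul0r//.
suff : phi (MkCp gY_in) x = g x by rewrite phig => /esym/eqP; exact/negP.
pose d z := phi (MkCp gY_in) z - g z.
have cd : continuous d.
  move=> z; apply: cvgB; [exact: Cp_continuous|exact: cg].
have : closed (d @^-1` [set 0]).
  by apply: preimage_closed => [z _|]; [exact: cd|exact: closed_eq].
move=> /(_ x) d0; apply/eqP; rewrite -subr_eq0; apply/eqP; apply: d0.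
apply: closureS clx => z Yz /=.
by rewrite /d -[z]/(set_val (exist _ z (mem_set Yz) : Y)) phiE subrr.
Qed.

Theorem theorem3p11 (R : realType) (X : metricType R) (Y : set X)
    (LX : free_lcs R X) (LY : free_lcs R Y) :
  [<-> closed Y; L_retract LX LY; ell_embedded R Y].
Proof.
tfae.
- exact: closed_L_retract.
- exact: L_retract_ell_embedded.
- exact: ell_embedded_closed.
Qed.
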